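(* Let $m\ge 4$ and $n\ge 5$ be integers. Consider the king-and-rook versus king endgame on an $m\times n$ board in the starting position: White king on $(m,1)$, White rook on $(1,1)$, Black king on $(m,n)$, with White to move. Let $FM(m,n)$ be the smallest number of White moves within which White can force checkmate. Then $$FM(m,n)=\begin{cases} n & \text{if } n \text{ is odd},\\ n+1 & \text{if } n \text{ is even}.\end{cases}$$
   Context: The board is the set of squares $(x,y)$ with $1\le x\le m$ (column) and $1\le y\le n$ (row). The pieces move and capture as in ordinary chess, restricted to this rectangular board: a king moves to any of the up to eight adjacent squares (including diagonally adjacent ones), and a rook moves any number of squares along its row or column without passing through another piece. The usual legality rules apply: a king may not move to a square attacked by an enemy piece, and the two kings may never be on adjacent squares. Black is checkmated if the Black king is attacked and Black has no legal move. White can force checkmate within $k$ moves if White has a strategy such that, against every sequence of legal Black replies, Black is checkmated by one of White's first $k$ moves. White moves first and the players alternate. *)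

(* Defs.v *)
From Stdlib Require Import Arith.

(* A square (x, y): x = column, y = row. *)
Definition sq := (nat * nat)%type.

Definition on_board (m n : nat) (s : sq) : Prop :=
  1 <= fst s <= m /\ 1 <= snd s <= n.

Definition adist (a b : nat) : nat := (a - b) + (b - a).

Definition near (s t : sq) : Prop :=
  adist (fst s) (fst t) <= 1 /\ adist (snd s) (snd t) <= 1.

Definition strictly_between (a c b : nat) : Prop :=
  (a < c /\ c < b) \/ (b < c /\ c < a).

Definition rook_line (r s : sq) : Prop :=
  (fst r = fst s \/ snd r = snd s) /\ r <> s.

Definition blocks (p r s : sq) : Prop :=
  (fst r = fst s /\ fst p = fst r /\ strictly_between (snd r) (snd p) (snd s)) \/
  (snd r = snd s /\ snd p = snd r /\ strictly_between (fst r) (fst p) (fst s)).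

(* A position: White king, White rook (None once captured), Black king. *)
Record pos := Pos { wk : sq; wr : option sq; bk : sq }.

(* Square s is attacked by White (White king at k, rook at wr); the only
   possible blocker of the rook is the White king (the Black king is the
   piece that moves, so it does not block). *)
Definition white_attacks (k : sq) (r0 : option sq) (s : sq) : Prop :=
  near k s \/
  exists r, r0 = Some r /\ r <> s /\ rook_line r s /\ ~ blocks k r s.

Definition in_check (p : pos) : Prop :=
  exists r, wr p = Some r /\ rook_line r (bk p) /\ ~ blocks (wk p) r (bk p).

Definition black_move (m n : nat) (p q : pos) : Prop :=
  wk q = wk p /\ near (bk p) (bk q) /\ bk q <> bk p /\ on_board m n (bk q) /\
  ~ white_attacks (wk p) (wr p) (bk q) /\
  ((wr p = Some (bk q) /\ wr q = None) \/ (wr p <> Some (bk q) /\ wr q = wr p)).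

Definition white_move (m n : nat) (p q : pos) : Prop :=
  bk q = bk p /\
  ( (near (wk p) (wk q) /\ wk q <> wk p /\ on_board m n (wk q) /\
     wr q = wr p /\ wr p <> Some (wk q) /\ ~ near (wk q) (bk p))
  \/ (exists r s, wr p = Some r /\ wr q = Some s /\ wk q = wk p /\
        on_board m n s /\ rook_line r s /\ ~ blocks (wk p) r s /\
        ~ blocks (bk p) r s /\ s <> wk p /\ s <> bk p) ).

Definition checkmated (m n : nat) (q : pos) : Prop :=
  in_check q /\ forall q', ~ black_move m n q q'.

(* White (to move in p) can force checkmate within k moves.  If after a
   White move Black is not mated and has no legal move (stalemate), the
   game is over without mate, so we require Black to have a legal move. *)
Fixpoint forces_mate (m n k : nat) (p : pos) : Prop :=
  match k with
  | 0 => False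
  | S k' => exists q, white_move m n p q /\
      (checkmated m n q \/
       ((exists r, black_move m n q r) /\
        forall r, black_move m n q r -> forces_mate m n k' r))
  end.

Definition start_pos (m n : nat) : pos := Pos (m, 1) (Some (1, 1)) (m, n).

(* Main.v *)
Require Import Defs.
From Stdlib Require Import Arith Bool List Lia.
Import ListNotations.

(* White cuts the Black king off on column m with the rook, loses a tempo with the
   rook if n is even, and marches up column m with the opposition: the Black king is
   driven to the corner and mated there.

   For the lower bound, count rows from the top: with k moves left and the White king
   in row d, call k + 1 - d the slack. A king step up keeps the slack and every other
   White move lowers it; with negative slack a Black king on the two top rows cannot
   be mated in time. The starting slack is 1 or 2, so White has at most two spare
   tempi, and Black only has to use the six columns next to the corner. Identifying
   all distant columns and rows leaves a finite game. A Black king that stays on the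
   first three columns holds as long as the White king is far, by a periodic invariant,
   and the last six moves are decided by computation. *)

(** * Forcing mate within k moves: monotonicity and refutation *)

Lemma forces_mate_S (m n k : nat) (p : pos) :
  forces_mate m n k p -> forces_mate m n (S k) p.
Proof.
  revert p; induction k as [|k IH]; intros p H; [contradiction|].
  destruct H as (q & Hq & [Hm | [He Hf]]); exists q; split; auto.
Qed.

Lemma forces_mate_le (m n k l : nat) (p : pos) :
  k <= l -> forces_mate m n k p -> forces_mate m n l p.
Proof. induction 1; auto using forces_mate_S. Qed.

(** Only the rook can give check, and a captured rook never returns. This settles every line in
    which Black takes the rook. *)
Lemma rook_needed (m n k : nat) (p : pos) :
  wr p = None -> ~ forces_mate m n k p.
Proof.
  revert p; induction k as [|k IH]; intros p Hp H; [exact H|].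
  destruct H as (q & [_ Hq] & H).
  assert (Hn : wr q = None).
  { destruct Hq as [(_ & _ & _ & E & _) | (r & s & E & _)]; congruence. }
  destruct H as [[(r & Hr & _) _] | [(r & Hr) Hf]]; [congruence|].
  apply (IH r); [|auto].
  destruct Hr as (_ & _ & _ & _ & _ & [[E _] | [_ E]]); congruence.
Qed.

(** What Black needs after a White move that leaves k further moves: a reply that holds, or no check
    together with either no White move left or stalemate. *)
Definition escapes (m n k : nat) (q : pos) : Prop :=
  (exists r, black_move m n q r /\ ~ forces_mate m n k r) \/
  (~ in_check q /\ (k = 0 \/ forall r, ~ black_move m n q r)).

Lemma escapes_not_forces (m n k : nat) (p : pos) :
  (forall q, white_move m n p q -> escapes m n k q) ->
  ~ forces_mate m n (S k) p.
Proof.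
  intros H (q & Hq & Hw).
  destruct (H q Hq) as [(r & Hr & Hn) | [Hc Hk]].
  - destruct Hw as [[_ Hm] | [_ Hf]]; [exact (Hm r Hr) | exact (Hn (Hf r Hr))].
  - destruct Hw as [[Hm _] | [(r & Hr) Hf]]; [exact (Hc Hm)|].
    destruct Hk as [-> | Hk]; [exact (Hf r Hr) | exact (Hk r Hr)].
Qed.

(** * Coordinates from the corner of the Black king *)

(* (x, y) counts columns and rows from the square (m, n). *)
Definition cpos (m n wx wy rx ry bx by_ : nat) : pos :=
  Pos (m - wx, n - wy) (Some (m - rx, n - ry)) (m - bx, n - by_).

Definition adjacent (x y x' y' : nat) : Prop :=
  (x <= x' + 1 /\ x' <= x + 1) /\ (y <= y' + 1 /\ y' <= y + 1).

Definition attacks (wx wy rx ry tx ty : nat) : Prop :=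
  rx = tx /\ ry <> ty /\ ~ (wx = rx /\ strictly_between ry wy ty) \/
  ry = ty /\ rx <> tx /\ ~ (wy = ry /\ strictly_between rx wx tx).

Lemma near_cpos (m n x y x' y' : nat) :
  x < m -> y < n -> x' < m -> y' < n ->
  near (m - x, n - y) (m - x', n - y') <-> adjacent x y x' y'.
Proof. unfold near, adjacent, adist; cbn; lia. Qed.

Lemma sub_flip (m x : nat) : 1 <= x <= m -> exists x', x' < m /\ x = m - x'.
Proof. exists (m - x); lia. Qed.

Lemma sub_eq_iff (m x y : nat) : x < m -> y < m -> m - x = m - y <-> x = y.
Proof. lia. Qed.

Lemma sub_lt_iff (m x y : nat) : x < m -> y < m -> m - x < m - y <-> y < x.
Proof. lia. Qed.

Lemma pair_neq (a b c d : nat) : (a, b) <> (c, d) <-> a <> c \/ b <> d.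
Proof.
  split; [|intros [?|?]; congruence].
  intros H; destruct (Nat.eq_dec a c) as [<-|]; [right; congruence | left; assumption].
Qed.

Lemma attacks_cpos (m n wx wy rx ry tx ty : nat) :
  wx < m -> rx < m -> tx < m -> wy < n -> ry < n -> ty < n ->
  (rook_line (m - rx, n - ry) (m - tx, n - ty) /\
   ~ blocks (m - wx, n - wy) (m - rx, n - ry) (m - tx, n - ty)) ->
  attacks wx wy rx ry tx ty.
Proof.
  intros ? ? ? ? ? ? [[Hl Hne] Hb]; unfold blocks, strictly_between, attacks in *.
  cbn in *; rewrite pair_neq in Hne.
  rewrite !sub_eq_iff in * by lia; rewrite !sub_lt_iff in Hb by lia.
  unfold strictly_between; lia.
Qed.

(** The right-hand side is generous to White: horizontally the rook may jump over either king,
    vertically over the Black king. A defence against more moves is still a defence, and fewer cases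
    remain to be tested. *)
Lemma white_move_cpos (m n wx wy rx ry bx by_ : nat) (q : pos) :
  wx < m -> wy < n -> rx < m -> ry < n -> bx < m -> by_ < n ->
  white_move m n (cpos m n wx wy rx ry bx by_) q ->
  (exists x y, x < m /\ y < n /\ adjacent x y wx wy /\ (x <> wx \/ y <> wy) /\
     (x <> rx \/ y <> ry) /\ ~ adjacent x y bx by_ /\
     q = cpos m n x y rx ry bx by_) \/
  (exists x y, x < m /\ y < n /\ (x = rx \/ y = ry) /\ (x <> rx \/ y <> ry) /\
     (x <> wx \/ y <> wy) /\ (x <> bx \/ y <> by_) /\
     ~ (wx = rx /\ wx = x /\ strictly_between ry wy y) /\
     q = cpos m n wx wy x y bx by_).
Proof.
  intros Hwx Hwy Hrx Hry Hbx Hby [Hb Hm].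
  destruct q as [[qx qy] qr qb]; unfold cpos in *; cbn in *; subst qb.
  destruct Hm as [(Hn & Hne & [Hx Hy] & -> & Hr & Ha) |
                  (r & [sx sy] & E & -> & E' & [Hx Hy] & [Hl Hne] & Hbl & _ & Hw & Hk)].
  - left; cbn in Hx, Hy.
    destruct (sub_flip m qx Hx) as (x & Hxm & ->).
    destruct (sub_flip n qy Hy) as (y & Hyn & ->).
    rewrite near_cpos in Hn, Ha by assumption; cbn in Hr; rewrite pair_neq in Hne.
    unfold adjacent in Hn.
    assert (Hr' : (m - x, n - y) <> (m - rx, n - ry)) by (intros E; apply Hr; rewrite E; reflexivity).
    rewrite pair_neq in Hr'.
    rewrite !sub_eq_iff in * by lia.
    exists x, y; unfold adjacent; repeat split; try lia; assumption.
  - right; cbn in Hx, Hy; injection E as <-; injection E' as -> ->.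
    destruct (sub_flip m sx Hx) as (x & Hxm & ->).
    destruct (sub_flip n sy Hy) as (y & Hyn & ->).
    rewrite pair_neq in Hne, Hw, Hk; unfold blocks, strictly_between in *; cbn in *.
    rewrite !sub_eq_iff in * by lia; rewrite !sub_lt_iff in Hbl by lia.
    exists x, y; repeat split; lia.
Qed.

(** The target may be the square of the rook: as the White king is not adjacent to it, the rook is
    unprotected and gets captured, whence the alternative [wr q = None]. *)
Lemma black_move_cpos (m n wx wy rx ry bx by_ tx ty : nat) :
  wx < m -> wy < n -> rx < m -> ry < n -> bx < m -> by_ < n -> tx < m -> ty < n ->
  adjacent tx ty bx by_ -> (tx <> bx \/ ty <> by_) -> ~ adjacent wx wy tx ty ->
  (rx = tx /\ ry = ty \/ ~ attacks wx wy rx ry tx ty) ->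
  exists q, black_move m n (cpos m n wx wy rx ry bx by_) q /\
    (wr q = None \/ (rx <> tx \/ ry <> ty) /\ q = cpos m n wx wy rx ry tx ty).
Proof.
  intros Hwx Hwy Hrx Hry Hbx Hby Htx Hty Hn Hne Hw Hr.
  assert (Hleg : forall q, wk q = (m - wx, n - wy) -> bk q = (m - tx, n - ty) ->
    (Some (m - rx, n - ry) = Some (bk q) /\ wr q = None \/
     Some (m - rx, n - ry) <> Some (bk q) /\ wr q = Some (m - rx, n - ry)) ->
    black_move m n (cpos m n wx wy rx ry bx by_) q).
  { intros q E1 E2 E3; unfold black_move, cpos; cbn; rewrite E1, E2 in *.
    split; [reflexivity|]. rewrite pair_neq.
    split; [apply near_cpos; auto; unfold adjacent in *; lia|].
    split; [lia|]. split; [unfold on_board; cbn; lia|]. split; [|exact E3].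
    intros [H | (r & [= <-] & Hrt & Hl & Hbl)].
    - apply Hw; rewrite near_cpos in H by assumption; exact H.
    - destruct Hr as [[-> ->] | Hr]; [congruence|].
      apply Hr; apply (attacks_cpos m n); auto. }
  destruct (Nat.eq_dec rx tx) as [Ex|Ex].
  1: destruct (Nat.eq_dec ry ty) as [Ey|Ey].
  - subst; eexists (Pos _ None _); split; [apply Hleg; cbn; auto|left; reflexivity].
  - eexists; split; [|right; split; [right; exact Ey|reflexivity]].
    apply Hleg; [reflexivity..|]. right; split; [|reflexivity].
    cbn; intros [= ? ?]; lia.
  - eexists; split; [|right; split; [left; exact Ex|reflexivity]].
    apply Hleg; [reflexivity..|]. right; split; [|reflexivity].
    cbn; intros [= ? ?]; lia.
Qed.

Lemma in_check_cpos (m n wx wy rx ry bx by_ : nat) :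
  wx < m -> wy < n -> rx < m -> ry < n -> bx < m -> by_ < n ->
  in_check (cpos m n wx wy rx ry bx by_) -> attacks wx wy rx ry bx by_.
Proof.
  intros ? ? ? ? ? ? (r & [= <-] & H); apply (attacks_cpos m n); auto.
Qed.

(** * The White king is too far away *)

(** A rook alone cannot confine the Black king to one square of the two top rows: with [c] a
    neighbouring column, either the rook itself can be taken or a step leaves both its row and its
    column. *)
Lemma escape_square (m rx ry bx by_ : nat) :
  2 <= m -> bx < m -> by_ <= 1 ->
  exists tx ty, tx < m /\ ty <= 1 /\ adjacent tx ty bx by_ /\ (tx <> bx \/ ty <> by_) /\
    (rx = tx /\ ry = ty \/ rx <> tx /\ ry <> ty).
Proof.
  intros Hm Hb Hy.
  assert (Hc : exists c, c < m /\ c <> bx /\ c <= bx + 1 /\ bx <= c + 1).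
  { destruct bx; [exists 1 | exists bx]; lia. }
  destruct Hc as (c & Hc & Hcb & Hd); unfold adjacent.
  destruct (Nat.eq_dec ry (1 - by_)) as [E|E].
  - destruct (Nat.eq_dec rx bx); [exists bx, (1 - by_)|].
    2: destruct (Nat.eq_dec rx c); [exists c, (1 - by_) | exists c, by_].
    all: repeat split; lia.
  - destruct (Nat.eq_dec rx bx); [exists c, (1 - by_) | exists bx, (1 - by_)]; repeat split; lia.
Qed.

(** From row 3 or lower the White king guards nothing in the two top rows, so the step given by
    [escape_square] is legal. The claim with White to move is a hypothesis, so that this half also
    serves inside the induction that proves it. *)
Lemma distant_king_black (m n k : nat) :
  2 <= m ->
  (forall wx d rx ry bx by_,
    wx < m -> d < n -> rx < m -> ry < n -> bx < m -> by_ <= 1 -> k + 2 <= d ->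
    ~ attacks wx d rx ry bx by_ -> ~ forces_mate m n k (cpos m n wx d rx ry bx by_)) ->
  forall wx d rx ry bx by_,
  wx < m -> d < n -> rx < m -> ry < n -> bx < m -> by_ <= 1 -> k + 2 <= d -> 3 <= d ->
  escapes m n k (cpos m n wx d rx ry bx by_).
Proof.
  intros Hm IH wx d rx ry bx by_ Hwx Hd Hrx Hry Hbx Hby Hk H3.
  destruct (escape_square m rx ry bx by_ Hm Hbx Hby) as (tx & ty & Htx & Hty & Hn & Hne & Hr).
  assert (Hr' : rx = tx /\ ry = ty \/ ~ attacks wx d rx ry tx ty).
  { unfold attacks; lia. }
  left; destruct (black_move_cpos m n wx d rx ry bx by_ tx ty) as (q & Hq & [E | [Hc ->]]);
    auto; try lia.
  - unfold adjacent; lia.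
  - exists q; auto using rook_needed.
  - eexists; split; [exact Hq|].
    destruct Hr' as [Hr'|Hr']; [lia|]. apply IH; auto; lia.
Qed.

(** Each White move lowers k by one and the row of the king by at most one, so the inequality
    between them persists until no move is left. *)
Lemma distant_king_white (m n k : nat) :
  2 <= m ->
  forall wx d rx ry bx by_,
  wx < m -> d < n -> rx < m -> ry < n -> bx < m -> by_ <= 1 -> k + 2 <= d ->
  ~ attacks wx d rx ry bx by_ -> ~ forces_mate m n k (cpos m n wx d rx ry bx by_).
Proof.
  intros Hm; induction k as [|k IH]; intros wx d rx ry bx by_ Hwx Hd Hrx Hry Hbx Hby Hk Ha;
    [exact id|].
  apply escapes_not_forces; intros q Hq.
  apply white_move_cpos in Hq; [|lia..].
  destruct Hq as [(x & y & Hx & Hy & Hadj & _ & _ & Hb & ->) |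
                  (x & y & Hx & Hy & _ & _ & _ & _ & _ & ->)].
  2: apply distant_king_black; auto; lia.
  destruct (Nat.le_gt_cases 3 y) as [H3|H3].
  { apply distant_king_black; auto; unfold adjacent in *; lia. }
  (* Only a discovered check can meet the king here, and Black steps out of it sideways. *)
  assert (Hy2 : y = 2 /\ d = 3 /\ k = 0) by (unfold adjacent in *; lia).
  destruct Hy2 as (-> & -> & ->).
  assert (Hdec : attacks x 2 rx ry bx by_ \/ ~ attacks x 2 rx ry bx by_).
  { unfold attacks, strictly_between; lia. }
  destruct Hdec as [Hat|Hat].
  2: { right; split; [|auto]. intros Hc; apply Hat, (in_check_cpos m n); auto; lia. }
  assert (Hs : exists c, c < m /\ c <> bx /\ c <= bx + 1 /\ bx <= c + 1).
  { destruct bx; [exists 1 | exists bx]; lia. }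
  destruct Hs as (c & Hc & Hcb & Hd1 & Hd2).
  unfold attacks, strictly_between, adjacent in *.
  left; destruct (black_move_cpos m n x 2 rx ry bx by_ c 0) as (q & Hq & _);
    unfold attacks, strictly_between, adjacent; try lia.
  exists q; split; [exact Hq | exact id].
Qed.

(** * Mating with the rook next to the edge column *)

Lemma black_move_stay (m n : nat) (w r b t : sq) :
  near b t -> t <> b -> on_board m n t -> ~ near w t -> t <> r ->
  (rook_line r t -> blocks w r t) ->
  black_move m n (Pos w (Some r) b) (Pos w (Some r) t).
Proof.
  intros Hn Hb Ho Hw Hr Ha; unfold black_move; cbn.
  repeat split; try apply Hn; try apply Ho; auto.
  - intros [H | (r' & [= <-] & _ & Hl & Hbl)]; auto.
  - right; split; congruence.
Qed.

Lemma black_move_inv (m n : nat) (w r b : sq) (p : pos) :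
  black_move m n (Pos w (Some r) b) p ->
  exists x y, near b (x, y) /\ (x, y) <> b /\ on_board m n (x, y) /\ ~ near w (x, y) /\
    ((x, y) = r \/
     p = Pos w (Some r) (x, y) /\ ~ (rook_line r (x, y) /\ ~ blocks w r (x, y))).
Proof.
  destruct p as [pw pr [x y]]; unfold black_move; cbn.
  intros (-> & Hn & Hb & Ho & Ha & Hr).
  assert (Hw : ~ near w (x, y)) by (intros H; apply Ha; left; exact H).
  exists x, y; do 4 (split; [assumption|]).
  destruct Hr as [[E ->] | [E ->]]; [left; congruence|].
  right; split; [reflexivity|]. intros [Hl Hbl]; apply Ha.
  right; exists r; repeat split; auto; try apply Hl; congruence.
Qed.

Ltac chess :=
  unfold near, on_board, rook_line, blocks, strictly_between, adist in *; cbn in *;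
  rewrite ?pair_neq in *; try lia.

(** The king goes to (m - 1, n - 2), shielding (m - 1, n) from its own rook; Black must step there.
    The rook then waits one column further off, which forces Black back into the corner, and mates
    along the top row. *)
Lemma corner_mate (m n r : nat) :
  4 <= m -> 5 <= n -> 1 <= r <= 2 ->
  forces_mate m n 3 (Pos (m, n - 3) (Some (m - 1, r)) (m, n)).
Proof.
  intros Hm Hn Hr.
  exists (Pos (m - 1, n - 2) (Some (m - 1, r)) (m, n)); split.
  { split; [reflexivity|]. left; cbn. repeat split; chess.
    intros [= E]; lia. }
  right; split.
  { eexists; apply (black_move_stay m n _ _ _ (m - 1, n)); chess. }
  intros p Hp; apply black_move_inv in Hp.
  destruct Hp as (x & y & Hnear & Hne & Ho & Hw & Hp).
  assert (E : x = m - 1 /\ y = n) by chess.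
  destruct E as [-> ->].
  destruct Hp as [E | [-> _]]; [injection E; lia|].
  exists (Pos (m - 1, n - 2) (Some (m - 2, r)) (m - 1, n)); split.
  { split; [reflexivity|]. right; exists (m - 1, r), (m - 2, r); cbn; repeat split; chess. }
  right; split.
  { eexists; apply (black_move_stay m n _ _ _ (m, n)); chess. }
  intros p Hp; apply black_move_inv in Hp.
  destruct Hp as (x & y & Hnear' & Hne' & Ho' & Hw' & Hp).
  assert (Hr' : (x, y) <> (m - 2, r)) by chess.
  destruct Hp as [E | [-> Ha]]; [contradiction|].
  assert (E : x = m /\ y = n) by chess.
  destruct E as [-> ->].
  exists (Pos (m - 1, n - 2) (Some (m - 2, n)) (m, n)); split.
  { split; [reflexivity|]. right; exists (m - 2, r), (m - 2, n); cbn; repeat split; chess. }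
  left; split.
  { exists (m - 2, n); cbn; repeat split; chess. }
  intros p Hp; apply black_move_inv in Hp.
  destruct Hp as (x & y & Hn' & Hne2 & Ho2 & Hw2 & Hp).
  destruct Hp as [E | [-> Ha2]]; [injection E as -> ->|]; chess.
Qed.

(** The rook confines Black to column m. An odd distance 3 + 2 h becomes even after a king step, and
    any Black reply makes it odd again: going up keeps h, going down lowers it. At h = 0 the step
    takes the opposition and Black can only go up. The index j counts the steps left to row n -
    3. *)
Lemma march_mates (m n r j : nat) :
  4 <= m -> 5 <= n -> 1 <= r <= 2 ->
  forall w b h, 1 <= w -> w + j + 3 = n -> b = w + 3 + 2 * h -> b <= n ->
  forces_mate m n (j + 3) (Pos (m, w) (Some (m - 1, r)) (m, b)).
Proof.
  intros Hm Hn Hr; induction j as [|j IH]; intros w b h Hw Hj Hb Hbn.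
  { replace w with (n - 3) by lia; replace b with n by lia; apply corner_mate; lia. }
  exists (Pos (m, w + 1) (Some (m - 1, r)) (m, b)); split.
  { split; [reflexivity|]. left; cbn; repeat split; chess.
    intros [= E]; lia. }
  right; split.
  (* Black is never stalemated: at b = n there is room below, since w + 3 < n forces h >= 1. *)
  { destruct (Nat.eq_dec b n).
    - eexists; apply (black_move_stay m n _ _ _ (m, b - 1)); chess.
    - eexists; apply (black_move_stay m n _ _ _ (m, b + 1)); chess. }
  intros p Hp; apply black_move_inv in Hp.
  destruct Hp as (x & y & Hnear & Hne & Ho & Hwk & Hp).
  assert (Hx : (x, y) <> (m - 1, r)) by chess.
  destruct Hp as [E | [-> Ha]]; [contradiction|].
  assert (E : x = m) by chess.
  subst x; destruct (Nat.eq_dec y (b + 1)).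
  - apply (IH (w + 1) y h); chess.
  - apply (IH (w + 1) y (h - 1)); chess.
Qed.

Lemma start_pos_forces_mate (m n : nat) :
  4 <= m -> 5 <= n ->
  forces_mate m n (if Nat.odd n then n else n + 1) (start_pos m n).
Proof.
  intros Hm Hn.
  assert (Hcut : forall k,
    forces_mate m n k (Pos (m, 1) (Some (m - 1, 1)) (m, n - 1)) ->
    forces_mate m n (S k) (start_pos m n)).
  { intros k Hk.
    exists (Pos (m, 1) (Some (m - 1, 1)) (m, n)); split.
    { split; [reflexivity|]. right; exists (1, 1), (m - 1, 1); cbn; repeat split; chess. }
    right; split.
    { eexists; apply (black_move_stay m n _ _ _ (m, n - 1)); chess. }
    intros p Hp; apply black_move_inv in Hp.
    destruct Hp as (x & y & Hnear & Hne & Ho & Hwk & Hp).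
    assert (Hx : (x, y) <> (m - 1, 1)) by chess.
    destruct Hp as [E | [-> Ha]]; [contradiction|].
    assert (E : x = m /\ y = n - 1) by chess.
    destruct E as [-> ->]; exact Hk. }
  destruct (Nat.odd n) eqn:E.
  - apply Nat.odd_spec in E; destruct E as [h Eh].
    (* One cutting move, n - 4 king steps from row 1 to row n - 3, and three mating moves. *)
    replace n with (S (n - 4 + 3)) at 2 by lia; apply Hcut.
    apply (march_mates m n 1 (n - 4) Hm Hn) with (h := h - 2); lia.
  - assert (Ev : Nat.Even n).
    { apply Nat.even_spec; rewrite <- Nat.negb_odd, E; reflexivity. }
    destruct Ev as [h Eh].
    replace (n + 1) with (S (S (n - 4 + 3))) by lia; apply Hcut.
    (* Waiting with the rook restores the opposition. *)
    exists (Pos (m, 1) (Some (m - 1, 2)) (m, n - 1)); split.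
    { split; [reflexivity|]. right; exists (m - 1, 1), (m - 1, 2); cbn; repeat split; chess. }
    right; split.
    { eexists; apply (black_move_stay m n _ _ _ (m, n)); chess. }
    intros p Hp; apply black_move_inv in Hp.
    destruct Hp as (x & y & Hnear & Hne & Ho & Hwk & Hp).
    assert (Hx : (x, y) <> (m - 1, 2)) by chess.
    destruct Hp as [E' | [-> Ha]]; [contradiction|].
    assert (E' : x = m) by chess.
    subst x; destruct (Nat.eq_dec y n).
    + apply (march_mates m n 2 (n - 4) Hm Hn) with (h := h - 2); chess.
    + apply (march_mates m n 2 (n - 4) Hm Hn) with (h := h - 3); chess.
Qed.

(** * Boolean tests for the computation *)

(* [&&] and [||] would evaluate both arguments under [vm_compute]. *)
Local Notation "a &&& b" := (if a then b else false) (at level 40, left associativity).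
Local Notation "a ||| b" := (if a then true else b) (at level 50, left associativity).

Fixpoint someb {A} (f : A -> bool) (l : list A) : bool :=
  match l with [] => false | x :: l' => f x ||| someb f l' end.

Fixpoint everyb {A} (f : A -> bool) (l : list A) : bool :=
  match l with [] => true | x :: l' => f x &&& everyb f l' end.

Lemma someb_In {A} (f : A -> bool) (l : list A) :
  someb f l = true -> exists x, In x l /\ f x = true.
Proof.
  induction l as [|x l IH]; cbn; [discriminate|].
  destruct (f x) eqn:E; [eauto|]. intros H; destruct (IH H) as (y & ? & ?); eauto.
Qed.

Lemma everyb_In {A} (f : A -> bool) (l : list A) (x : A) :
  everyb f l = true -> In x l -> f x = true.
Proof.
  induction l as [|y l IH]; cbn; [contradiction|].
  destruct (f y) eqn:E; [|discriminate]. intros H [<-|Hx]; auto.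
Qed.

Fixpoint closeb (a b : nat) : bool :=
  match a, b with
  | 0, (0 | 1) | 1, 0 => true
  | S a', S b' => closeb a' b'
  | _, _ => false
  end.

Lemma closeb_spec (a b : nat) : closeb a b = true <-> a <= b + 1 /\ b <= a + 1.
Proof.
  revert b; induction a as [|a IH]; intros b.
  - destruct b as [|[|b]]; cbn; split; (lia || discriminate || reflexivity).
  - destruct b as [|b].
    + destruct a; cbn; split; (lia || discriminate || reflexivity).
    + replace (closeb (S a) (S b)) with (closeb a b) by (destruct a; reflexivity).
      rewrite IH; lia.
Qed.

Definition nearb (s t : sq) : bool :=
  closeb (fst s) (fst t) &&& closeb (snd s) (snd t).

Definition eqb_sq (s t : sq) : bool := (fst s =? fst t) &&& (snd s =? snd t).

Definition betweenb (a c b : nat) : bool :=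
  (a <? c) &&& (c <? b) ||| (b <? c) &&& (c <? a).

Lemma and_true (a b : bool) : a &&& b = true <-> a = true /\ b = true.
Proof. destruct a; intuition discriminate. Qed.

Lemma or_true (a b : bool) : a ||| b = true <-> a = true \/ b = true.
Proof. destruct a; intuition discriminate. Qed.

(** * A finite abstraction of the board *)

(* Only rows 0 to 3 of the rook are recorded exactly: class 4 is a rook above the
   White king (in row d), class 5 a rook level with it or below it. *)
Definition row_class (ry d : nat) : nat :=
  if ry <? 4 then ry else if ry <? d then 4 else 5.

(** The value false guarantees an unattacked target. On the column of its king, a class 5 rook is
    shielded exactly from targets above the king; a class 4 rook already stands between the king and
    every target in rows 0 to 3. *)
Definition hits (w r t : sq) : bool :=
  if fst r =? fst t then
    negb ((fst w =? fst r) &&&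
          (if snd r =? 5 then snd t <? snd w
           else if snd r =? 4 then false
           else betweenb (snd r) (snd w) (snd t)))
  else (snd r =? snd t) &&&
    negb ((snd w =? snd r) &&& betweenb (fst r) (fst w) (fst t)).

Definition around (x bound : nat) : list nat :=
  filter (fun z => (z <? bound) &&& closeb z x) (seq (x - 1) 3).

(** Black replies only within six columns and four rows, where the classes record squares
    exactly. *)
Definition king_targets (M : nat) (b : sq) : list sq :=
  filter (fun t => negb (eqb_sq t b))
    (list_prod (around (fst b) (min M 6)) (around (snd b) 4)).

(* Arguments: the slack k + 1 - d, where White has k moves left and the White king
   is in row d; the column of the White king; the rook; the Black king. *)
Definition posset := nat -> nat -> sq -> sq -> bool.

(* The last alternative needs no reply: without a check, Black is also saved when White
   has no move left, and by the one stalemate that the defence relies on. *)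
Definition survives (G : posset) (k d : nat) (w r b : sq) (ts : list sq) : bool :=
  (k + 2 <=? d) &&& (3 <=? d) &&& (snd b <=? 1)
  ||| someb (fun t =>
       negb (nearb w t) &&&
       (eqb_sq t r |||
        negb (hits w r t) &&&
        ((k =? 0) |||
         (if k + 2 <=? d then snd t <=? 1 else G (k + 1 - d) (fst w) r t)))) ts
  ||| negb (fst r =? fst b) &&& negb (snd r =? snd b) &&&
     ((k =? 0) ||| eqb_sq b (0, 0) &&& eqb_sq w (0, 2) &&& (fst r =? 1) &&& (2 <=? snd r)).

(* The classes a fixed rook may get when the White king goes from row d to row d'. *)
Definition class_moves (rc d d' : nat) : list nat :=
  if rc <? 4 then [rc]
  else if d' =? d then [rc]
  else if d' <? d then (if rc =? 5 then [5] else if 4 <? d' then [4; 5] else [5])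
  else if rc =? 4 then [4] else if 4 <? d' then [4; 5] else [5].

(** Compares a rook class with the row of the White king. A change of this value along the column of
    the king exposes an illegal jump over it. *)
Definition below (d y : nat) : bool :=
  if y =? 5 then true else if y =? 4 then false else d <? y.

(* All columns from 7 on are identified, hence the tests [x <? 7]: two pieces in that
   class need not share a square, nor is a move within it a null move. *)
Definition safe (M : nat) (G : posset) (k d : nat) (w r b : sq) : bool :=
  let ts := king_targets M b in
  everyb (fun d' => everyb (fun x =>
    (d' =? d) &&& (x =? fst w) &&& (x <? 7) |||
    nearb (x, min d' 5) b |||
    everyb (fun rc =>
      eqb_sq (x, min d' 5) (fst r, rc) &&& (x <? 7) &&& (rc <? 4) |||
      survives G k d' (x, min d' 5) (fst r, rc) b ts)
      (class_moves (snd r) d d'))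
    (around (fst w) M)) (around d (d + 2)) &&&
  everyb (fun x =>
    (x =? fst r) &&& (x <? 7) ||| eqb_sq (x, snd r) b |||
    eqb_sq (x, snd r) w &&& (x <? 7) &&& (snd r <? 4) |||
    survives G k d w (x, snd r) b ts) (seq 0 M) &&&
  everyb (fun y =>
    (y =? snd r) &&& (y <? 4) ||| (y =? 4) &&& (d <=? 4) ||| eqb_sq (fst r, y) b |||
    eqb_sq (fst r, y) w &&& (fst r <? 7) &&& (y <? 4) |||
    (fst w =? fst r) &&& (fst r <? 7) &&& xorb (below (snd w) (snd r)) (below (snd w) y) |||
    survives G k d w (fst r, y) b ts) (seq 0 6).

Lemma nearb_spec (x y x' y' : nat) : nearb (x, y) (x', y') = true <-> adjacent x y x' y'.
Proof. unfold nearb; cbn; rewrite and_true, !closeb_spec; reflexivity. Qed.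

Lemma eqb_sq_spec (x y x' y' : nat) : eqb_sq (x, y) (x', y') = true <-> x = x' /\ y = y'.
Proof. unfold eqb_sq; cbn; rewrite and_true, !Nat.eqb_eq; reflexivity. Qed.

Lemma betweenb_spec (a c b : nat) : betweenb a c b = true <-> strictly_between a c b.
Proof.
  unfold betweenb, strictly_between; rewrite or_true, !and_true, !Nat.ltb_lt; reflexivity.
Qed.

Lemma In_around (x z bound : nat) :
  In z (around x bound) <-> z < bound /\ z <= x + 1 /\ x <= z + 1.
Proof.
  unfold around; rewrite filter_In, in_seq, and_true, Nat.ltb_lt, closeb_spec; lia.
Qed.

Lemma In_king_targets (M bx by_ x y : nat) :
  In (x, y) (king_targets M (bx, by_)) ->
  x < min M 6 /\ y < 4 /\ adjacent x y bx by_ /\ (x <> bx \/ y <> by_).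
Proof.
  unfold king_targets; rewrite filter_In, in_prod_iff, !In_around, negb_true_iff.
  cbn; intros [[Hx Hy] He]; unfold adjacent.
  destruct (Nat.eq_dec x bx), (Nat.eq_dec y by_); try lia.
  assert (eqb_sq (x, y) (bx, by_) = true) by (apply eqb_sq_spec; auto); congruence.
Qed.

Lemma hits_sound (wx d rx ry tx ty : nat) :
  tx <= 5 -> ty <= 3 -> (rx <> wx \/ ry <> d) ->
  hits (min wx 7, min d 5) (min rx 7, row_class ry d) (tx, ty) = false ->
  ~ attacks wx d rx ry tx ty.
Proof.
  intros Htx Hty Hne H Ha; unfold hits in H; cbn [fst snd] in H.
  unfold row_class, attacks in *.
  destruct Ha as [(-> & Hy & Hb) | (-> & Hx & Hb)].
  - replace (min tx 7 =? tx) with true in H by (symmetry; apply Nat.eqb_eq; lia).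
    rewrite negb_false_iff, and_true, Nat.eqb_eq in H; destruct H as [Hw H].
    apply Hb; split; [lia|]. unfold strictly_between.
    destruct (Nat.ltb_spec ry 4).
    + replace (ry =? 5) with false in H by (symmetry; apply Nat.eqb_neq; lia).
      replace (ry =? 4) with false in H by (symmetry; apply Nat.eqb_neq; lia).
      rewrite betweenb_spec in H; unfold strictly_between in H; lia.
    + destruct (Nat.ltb_spec ry d); cbn in H; [discriminate|].
      apply Nat.ltb_lt in H; lia.
  - replace (ty <? 4) with true in H by (symmetry; apply Nat.ltb_lt; lia).
    replace (min rx 7 =? tx) with false in H by (symmetry; apply Nat.eqb_neq; lia).
    rewrite Nat.eqb_refl, negb_false_iff, and_true, Nat.eqb_eq, betweenb_spec in H.
    unfold strictly_between in *; lia.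
Qed.

(** * Soundness of the abstraction *)

(** The test ran with [ke] moves and row [e], the true values being [k] and [d]. Both pairs have the
    same slack and the same row class, so one computation covers all distant rows; [ke = 0 -> k = 0]
    keeps the test for the last move valid. *)
Lemma survives_sound (m n k ke d e : nat) (G : posset) (wx rx ry bx by_ : nat) :
  4 <= m -> 5 <= n ->
  (forall tx ty, tx < m -> ty < n -> (rx <> wx \/ ry <> d) -> d <= k + 1 ->
     G (k + 1 - d) (min wx 7) (min rx 7, row_class ry d) (tx, ty) = true ->
     ~ forces_mate m n k (cpos m n wx d rx ry tx ty)) ->
  wx < m -> d < n -> rx < m -> ry < n -> bx < m -> by_ < n -> bx <= 5 -> by_ <= 3 ->
  (rx <> wx \/ ry <> d) ->
  ke + d = k + e -> min e 5 = min d 5 -> (ke = 0 -> k = 0) ->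
  survives G ke e (min wx 7, min e 5) (min rx 7, row_class ry d) (bx, by_)
    (king_targets (min m 8) (bx, by_)) = true ->
  escapes m n k (cpos m n wx d rx ry bx by_).
Proof.
  intros Hm Hn HG Hwx Hd Hrx Hry Hbx Hby Hbx5 Hby3 Hrw Hk He Hk0 H.
  rewrite He in H; unfold survives in H; rewrite !or_true in H.
  destruct H as [[H | H] | H].
  - rewrite !and_true, !Nat.leb_le in H; cbn [fst snd] in H.
    apply distant_king_black; try lia.
    intros; apply distant_king_white; auto; lia.
  - apply someb_In in H; destruct H as ([tx ty] & Ht & H).
    apply In_king_targets in Ht; destruct Ht as (Htx & Hty & Hadj & Hne).
    rewrite and_true, or_true in H; destruct H as [Hnear H].
    assert (Hw : ~ adjacent wx d tx ty).
    { intros Ha. rewrite negb_true_iff in Hnear.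
      assert (nearb (min wx 7, min d 5) (tx, ty) = true); [|congruence].
      apply nearb_spec; unfold adjacent in *; lia. }
    assert (Hr : rx = tx /\ ry = ty \/ ~ attacks wx d rx ry tx ty /\
      (k = 0 \/ k + 2 <= d /\ ty <= 1 \/
       d <= k + 1 /\ G (k + 1 - d) (min wx 7) (min rx 7, row_class ry d) (tx, ty) = true)).
    { destruct H as [H | H].
      - left; apply eqb_sq_spec in H; destruct H as [H1 H2].
        unfold row_class in H2; destruct (Nat.ltb_spec ry 4); [lia|].
        destruct (ry <? d); lia.
      - rewrite and_true, negb_true_iff in H; destruct H as [H1 H2].
        right; split; [apply hits_sound; auto; lia|].
        rewrite or_true, Nat.eqb_eq in H2; destruct H2 as [H2 | H2]; [auto|].
        right. destruct (Nat.leb_spec (ke + 2) e).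
        + left; apply Nat.leb_le in H2; cbn in H2; lia.
        + right; split; [lia|]. replace (k + 1 - d) with (ke + 1 - e) by lia; exact H2. }
    left; destruct (black_move_cpos m n wx d rx ry bx by_ tx ty) as (q & Hq & Hq');
      auto; try lia; [tauto|].
    exists q; split; [exact Hq|].
    destruct Hq' as [Hq' | [Hne' ->]]; [auto using rook_needed|].
    destruct Hr as [Hr | [Hna [-> | [[Hkd Ht1] | [Hkd HGt]]]]]; [lia| exact id | |].
    + apply distant_king_white; auto; lia.
    + apply HG; auto; lia.
  - right. rewrite !and_true, or_true, !and_true in H.
    rewrite !negb_true_iff, !Nat.eqb_neq, !eqb_sq_spec, !Nat.eqb_eq, Nat.leb_le in H.
    cbn [fst snd] in H. destruct H as [[Hx Hy] H].
    assert (Hal : rx <> bx /\ ry <> by_).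
    { unfold row_class in Hy; split; [lia|]. intros ->.
      apply Hy; destruct (Nat.ltb_spec by_ 4); lia. }
    split.
    { intros Hc; apply in_check_cpos in Hc; auto; unfold attacks in Hc; lia. }
    destruct H as [H | [[[[Hb1 Hb2] [Hw1 Hw2]] Hr1] Hr2]]; [auto|].
    (* The stalemate: the White king guards (0, 1) and (1, 1), the rook guards (1, 0) along its
       column. *)
    right; intros p Hp; subst bx by_.
    assert (E : wx = 0 /\ d = 2 /\ rx = 1) by lia; destruct E as (-> & -> & ->).
    assert (Hry2 : 2 <= ry).
    { unfold row_class in Hr2; destruct (Nat.ltb_spec ry 4); lia. }
    destruct p as [pw pr [px py]].
    destruct Hp as (_ & Hpn & Hpne & [Hpx Hpy] & Ha & Hp); cbn in *.
    destruct (sub_flip m px Hpx) as (x & Hxm & ->).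
    destruct (sub_flip n py Hpy) as (y & Hyn & ->).
    rewrite near_cpos in Hpn by lia.
    rewrite pair_neq, !sub_eq_iff in Hpne by lia.
    assert (Hnw : ~ adjacent 0 2 x y).
    { intros Hadj; apply Ha; left; apply near_cpos; auto; lia. }
    unfold adjacent in *; assert (E : x = 1 /\ y = 0) by lia; destruct E as [-> ->].
    apply Ha; right; exists (m - 1, n - ry); split; [reflexivity|].
    unfold rook_line, blocks, strictly_between; cbn; rewrite pair_neq; lia.
Qed.

(** The bound on [d] keeps truncated subtraction from confusing negative slack with slack 0;
    negative slack is the case of the distant king. *)
Definition sound (m n k : nat) (G : posset) : Prop :=
  forall wx d rx ry bx by_,
  wx < m -> d < n -> rx < m -> ry < n -> bx < m -> by_ < n -> (rx <> wx \/ ry <> d) ->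
  d <= k + 1 ->
  G (k + 1 - d) (min wx 7) (min rx 7, row_class ry d) (bx, by_) = true ->
  ~ forces_mate m n k (cpos m n wx d rx ry bx by_).

Lemma row_class_cases (ry d : nat) :
  (ry < 4 /\ row_class ry d = ry) \/ (4 <= ry < d /\ row_class ry d = 4) \/
  (4 <= ry /\ d <= ry /\ row_class ry d = 5).
Proof.
  unfold row_class; destruct (Nat.ltb_spec ry 4), (Nat.ltb_spec ry d); lia.
Qed.

Lemma below_row_class (y d : nat) :
  y <> d -> below (min d 5) (row_class y d) = (d <? y).
Proof.
  intros Hy; unfold below.
  destruct (row_class_cases y d) as [[H ->] | [[H ->] | [H [H' ->]]]].
  - destruct (Nat.eqb_spec y 5); [lia|]. destruct (Nat.eqb_spec y 4); [lia|].
    destruct (Nat.ltb_spec d y), (Nat.ltb_spec (min d 5) y); lia.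
  - symmetry; apply Nat.ltb_ge; lia.
  - symmetry; apply Nat.ltb_lt; lia.
Qed.

Lemma In_class_moves (ry d d' e e' : nat) :
  d <= d' + 1 -> d' <= d + 1 -> e' + d = e + d' -> min e' 5 = min d' 5 ->
  In (row_class ry d') (class_moves (row_class ry d) e e').
Proof.
  intros H1 H2 He H5.
  generalize (row_class_cases ry d), (row_class_cases ry d').
  generalize (row_class ry d), (row_class ry d'); intros c c' Hc Hc'.
  unfold class_moves.
  repeat match goal with
  | |- context [?a =? ?b] => destruct (Nat.eqb_spec a b)
  | |- context [?a <? ?b] => destruct (Nat.ltb_spec a b)
  end; cbn [In]; lia.
Qed.

(** Either the test ran on the true row, or on a row [e] >= 6, from which every king step still
    lands in row class 5, just as from [d]. *)
Lemma safe_sound (m n k ke d e : nat) (G : posset) (wx rx ry bx by_ : nat) :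
  4 <= m -> 5 <= n -> sound m n k G ->
  wx < m -> d < n -> rx < m -> ry < n -> bx < m -> by_ < n -> bx <= 5 -> by_ <= 3 ->
  (rx <> wx \/ ry <> d) ->
  ke + d = k + e -> (e = d \/ 6 <= e <= d) -> (ke = 0 -> k = 0) ->
  safe (min m 8) G ke e (min wx 7, min e 5) (min rx 7, row_class ry d) (bx, by_) = true ->
  ~ forces_mate m n (S k) (cpos m n wx d rx ry bx by_).
Proof.
  intros Hm Hn HG Hwx Hd Hrx Hry Hbx Hby Hbx5 Hby3 Hrw Hk He Hk0 H.
  unfold safe in H; cbv zeta in H; rewrite !and_true in H; destruct H as [[HK HH] HV].
  cbn [fst snd] in *.
  apply escapes_not_forces; intros q Hq.
  apply white_move_cpos in Hq; auto.
  destruct Hq as [(x & y & Hx & Hy & [Hax Hay] & Hne & Hnr & Hnb & ->) |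
                  (x & y & Hx & Hy & Hl & Hne & Hnw & Hnb & Hbl & ->)].
  - clear HH HV.
    (* [e'] is the new row of the White king in the frame of the test. *)
    assert (He' : exists e', e' + d = e + y) by (exists (e + y - d); lia).
    destruct He' as (e' & He').
    assert (H5 : min e' 5 = min y 5) by lia.
    apply everyb_In with (x := e') in HK; [|apply In_around; lia].
    apply everyb_In with (x := min x 7) in HK; [|apply In_around; lia].
    rewrite !or_true, nearb_spec, !and_true, !Nat.eqb_eq, Nat.ltb_lt in HK.
    destruct HK as [[HK | HK] | HK].
    + exfalso; clear - He' HK Hne; lia.
    + exfalso; apply Hnb; clear - HK H5 Hbx5 Hby3; unfold adjacent in *; lia.
    + apply everyb_In with (x := row_class ry y) in HK;
        [|apply In_class_moves; auto; lia].
      rewrite or_true, !and_true, eqb_sq_spec, !Nat.ltb_lt in HK.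
      destruct HK as [HK | HK].
      * exfalso; clear - HK H5 Hnr.
        destruct (row_class_cases ry y) as [[Hr E] | [[Hr E] | [Hr [Hr' E]]]]; lia.
      * apply (survives_sound m n k ke y e' G) in HK; auto; try lia.
  - clear HK.
    assert (Hsv : survives G ke e (min wx 7, min e 5) (min x 7, row_class y d) (bx, by_)
        (king_targets (min m 8) (bx, by_)) = true ->
      escapes m n k (cpos m n wx d x y bx by_)).
    { apply survives_sound; auto; clear HH HV; try lia. }
    destruct (Nat.eq_dec y ry) as [->|Hyr].
    + clear HV; apply everyb_In with (x := min x 7) in HH; [|apply in_seq; lia].
      rewrite !or_true, !and_true, !eqb_sq_spec, Nat.eqb_eq, !Nat.ltb_lt in HH.
      destruct HH as [[[HH | HH] | HH] | HH]; [exfalso ..|auto];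
        clear - HH Hne Hnb Hnw He Hbx5 Hby3;
        destruct (row_class_cases ry d) as [[Hr E] | [[Hr E] | [Hr [Hr' E]]]]; lia.
    + assert (x = rx) by lia; subst x.
      clear HH; apply everyb_In with (x := row_class y d) in HV.
      2: { apply in_seq; destruct (row_class_cases y d) as [[Hr E] | [[Hr E] | [Hr [Hr' E]]]]; lia. }
      rewrite !or_true, !and_true, !eqb_sq_spec, !Nat.eqb_eq, !Nat.ltb_lt, Nat.leb_le in HV.
      destruct HV as [[[[[HV | HV] | HV] | HV] | HV] | HV]; [exfalso ..|auto].
      (* The excluded vertical move in which the rook passes over its own king. *)
      5: { clear Hsv HG Hl Hnb Hk Hk0; destruct HV as [[E1 E2] E3]; apply Hbl; split; [lia|]. split; [lia|].
        replace (min e 5) with (min d 5) in E3 by lia.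
        rewrite !below_row_class in E3 by lia; unfold strictly_between.
        destruct (Nat.ltb_spec d ry), (Nat.ltb_spec d y); try discriminate; lia. }
      all: clear - HV Hyr Hne Hnb Hnw He Hbx5 Hby3;
        destruct (row_class_cases ry d) as [[Hr E] | [[Hr E] | [Hr [Hr' E]]]];
        destruct (row_class_cases y d) as [[Hs F] | [[Hs F] | [Hs [Hs' F]]]]; lia.
Qed.

(** * Tables for the last six moves *)

(** A memo, indexed by slack, White king column, rook column and row class, Black king column and
    row, so that each position is evaluated once per k. *)
Definition table := list (list (list (list (list (list bool))))).

(** The defaults make every look-up outside the table false, so nothing is claimed there. *)
Definition entry (T : table) : posset := fun s wx r b =>
  nth (snd b) (nth (fst b) (nth (snd r) (nth (fst r) (nth wx (nth s T []) []) []) []) []) false.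

Definition tabulate {A} (f : nat -> A) (n : nat) : list A := map f (seq 0 n).

Lemma nth_tabulate {A} (f : nat -> A) (n i : nat) (x : A) :
  nth i (tabulate f n) x = if i <? n then f i else x.
Proof.
  unfold tabulate; destruct (Nat.ltb_spec i n).
  - rewrite nth_indep with (d' := f 0) by (rewrite length_map, length_seq; lia).
    rewrite map_nth, seq_nth by lia; reflexivity.
  - apply nth_overflow; rewrite length_map, length_seq; lia.
Qed.

(* Slack 2 means that White has made no detour yet, so the rook is still on (1, 1). *)
Definition step (M k : nat) (G : posset) : table :=
  tabulate (fun s => tabulate (fun wx => tabulate (fun rx => tabulate (fun rc =>
  tabulate (fun bx => tabulate (fun by_ =>
    let d := S k + 1 - s in
    let w := (wx, min d 5) in
    ((s <? 2) ||| (rx =? M - 1) &&& (rc =? 5)) &&&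
    negb (nearb w (bx, by_)) &&& negb (hits w (rx, rc) (bx, by_)) &&&
    safe M G k d w (rx, rc) (bx, by_))
    3) (min M 6)) 6) M) M) 3.

Fixpoint tables (M k : nat) : table :=
  match k with
  | 0 => []
  | S k' => let T := tables M k' in step M k' (entry T)
  end.

Lemma entry_step (M k : nat) (G : posset) (s wx : nat) (r b : sq) :
  entry (step M k G) s wx r b = true ->
  s < 3 /\ fst b < 6 /\ snd b < 3 /\
  safe M G k (S k + 1 - s) (wx, min (S k + 1 - s) 5) r b = true.
Proof.
  assert (Hnil : forall A i (x : A), nth i [] x = x) by (intros A [|i]; reflexivity).
  destruct r as [rx rc], b as [bx by_]; unfold entry, step; cbn [fst snd].
  repeat (rewrite ?Hnil; rewrite nth_tabulate;
          match goal with |- context [?a <? ?b] => destruct (Nat.ltb_spec a b) end;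
          rewrite ?Hnil; try discriminate).
  cbv zeta; rewrite !and_true; intros Hs; repeat split; try lia; apply Hs.
Qed.

Lemma tables_sound (m n k : nat) :
  4 <= m -> 5 <= n -> k <= 6 -> sound m n k (entry (tables (min m 8) k)).
Proof.
  intros Hm Hn; induction k as [|k IH]; intros Hk wx d rx ry bx by_;
    intros Hwx Hd Hrx Hry Hbx Hby Hrw Hdk H; [exact id|].
  cbn [tables] in H; cbv zeta in H; apply entry_step in H; cbn [fst snd] in H.
  destruct H as (Hs & Hb & Hb' & H).
  replace (S k + 1 - (S k + 1 - d)) with d in H by lia.
  apply (safe_sound m n k k d d (entry (tables (min m 8) k))) in H; auto; try lia.
  apply IH; lia.
Qed.

(** * The periodic invariant for a distant White king *)

(* For k >= 6 the Black king keeps to three columns. Column 0 is dangerous: there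
   the opposition of the kings, hence the parity p of k, decides. *)
Definition far (M p : nat) : posset := fun s wx r b =>
  (s <? 3) &&& (fst b <? 3) &&& (snd b <? 2) &&& negb (hits (wx, 5) r b) &&&
  ((s =? 0) |||
   (0 <? fst b) &&& ((s =? 1) ||| eqb_sq r (M - 1, 5)) |||
   (wx =? 0) &&& ((s =? 1) &&& (snd b =? p) &&& eqb_sq r (1, 5) |||
                  (p =? 0) &&& (snd b =? 0) &&& eqb_sq r (M - 1, 5))).

Definition far_all (M p : nat) (Q : nat -> nat -> sq -> sq -> bool) : bool :=
  everyb (fun s => everyb (fun wx => everyb (fun rx => everyb (fun rc =>
  everyb (fun bx => everyb (fun by_ =>
    negb (far M p s wx (rx, rc) (bx, by_)) ||| Q s wx (rx, rc) (bx, by_))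
    (seq 0 2)) (seq 0 3)) (seq 0 6)) (seq 0 M)) (seq 0 M)) (seq 0 3).

Lemma far_all_spec (M p : nat) (Q : posset) (s wx rx rc bx by_ : nat) :
  far_all M p Q = true -> wx < M -> rx < M -> rc < 6 ->
  far M p s wx (rx, rc) (bx, by_) = true -> Q s wx (rx, rc) (bx, by_) = true.
Proof.
  intros H Hwx Hrx Hrc Hf.
  assert (Hr : s < 3 /\ bx < 3 /\ by_ < 2).
  { unfold far in Hf; rewrite !and_true, !Nat.ltb_lt in Hf; cbn in Hf; tauto. }
  unfold far_all in H.
  apply everyb_In with (x := s) in H; [|apply in_seq; lia].
  apply everyb_In with (x := wx) in H; [|apply in_seq; lia].
  apply everyb_In with (x := rx) in H; [|apply in_seq; lia].
  apply everyb_In with (x := rc) in H; [|apply in_seq; lia].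
  apply everyb_In with (x := bx) in H; [|apply in_seq; lia].
  apply everyb_In with (x := by_) in H; [|apply in_seq; lia].
  rewrite or_true, Hf in H; destruct H; [discriminate|assumption].
Qed.

(** In order: the start for n = 5; the passage from [far] to the tables at k = 6; the two steps that
    swap parities. Row 6 represents all distant rows: there slack s means s + 5 moves before White
    plays and s + 4 after. *)
Definition checks (M : nat) : bool :=
  (let T := tables M 4 in entry T 1 0 (M - 1, 5) (0, 0)) &&&
  (let T := tables M 6 in far_all M 0 (entry T)) &&&
  far_all M 0 (fun s wx r b => safe M (far M 1) (s + 4) 6 (wx, 5) r b) &&&
  far_all M 1 (fun s wx r b => safe M (far M 0) (s + 4) 6 (wx, 5) r b).

(** Five widths suffice: as column class 7 holds all columns from 7 on, every board with m >= 8 has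
    the same eight classes. *)
Lemma all_checks : everyb checks [4; 5; 6; 7; 8] = true.
Proof. vm_compute; reflexivity. Qed.

Lemma checks_min (m : nat) : 4 <= m -> checks (min m 8) = true.
Proof.
  intros Hm; apply (everyb_In _ _ _ all_checks).
  assert (E : min m 8 = 4 \/ min m 8 = 5 \/ min m 8 = 6 \/ min m 8 = 7 \/ min m 8 = 8) by lia.
  destruct E as [-> | [-> | [-> | [-> | ->]]]]; cbn; auto 6.
Qed.

Lemma row_class_lt (ry d : nat) : row_class ry d < 6.
Proof. destruct (row_class_cases ry d) as [[H ->] | [[H ->] | [H [H' ->]]]]; lia. Qed.

(** A White move can be answered so as to re-enter [far] with the other parity, or to hold outright;
    the induction starts from the table at k = 6. *)
Lemma far_sound (m n k : nat) :
  4 <= m -> 5 <= n -> 6 <= k -> sound m n k (far (min m 8) (k mod 2)).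
Proof.
  intros Hm Hn Hk.
  pose proof (checks_min m Hm) as Hc; unfold checks in Hc; cbv zeta in Hc.
  rewrite !and_true in Hc; destruct Hc as [[[_ Hbase] Heven] Hodd].
  induction Hk as [|k Hk IH]; intros wx d rx ry bx by_;
    intros Hwx Hd Hrx Hry Hbx Hby Hrw Hdk H.
  - apply (tables_sound m n 6); auto.
    change (6 mod 2) with 0 in H.
    apply (far_all_spec (min m 8) 0 (entry (tables (min m 8) 6))); auto using row_class_lt; lia.
  - assert (Hs : S k + 1 - d < 3 /\ bx < 3 /\ by_ < 2).
    { unfold far in H; rewrite !and_true, !Nat.ltb_lt in H; cbn [fst snd] in H; tauto. }
    destruct Hs as (Hs & Hbx3 & Hby2).
    (* Slack at most 2 with [S k] moves left gives d >= k >= 6, so row 6 may stand for [d]. *)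
    assert (Hsafe : safe (min m 8) (far (min m 8) (k mod 2)) (S k + 1 - d + 4) 6
      (min wx 7, min 6 5) (min rx 7, row_class ry d) (bx, by_) = true).
    { destruct (Nat.Even_or_Odd k) as [[h Eh] | [h Eh]].
      - replace (S k mod 2) with 1 in H by (subst k; apply Nat.mod_unique with h; lia).
        replace (k mod 2) with 0 by (subst k; apply Nat.mod_unique with h; lia).
        refine (far_all_spec (min m 8) 1 (fun s wx r b =>
          safe (min m 8) (far (min m 8) 0) (s + 4) 6 (wx, 5) r b) _ _ _ _ _ _ Hodd _ _ _ H);
          auto using row_class_lt; lia.
      - replace (S k mod 2) with 0 in H by (subst k; apply Nat.mod_unique with (S h); lia).
        replace (k mod 2) with 1 by (subst k; apply Nat.mod_unique with h; lia).
        refine (far_all_spec (min m 8) 0 (fun s wx r b =>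
          safe (min m 8) (far (min m 8) 1) (s + 4) 6 (wx, 5) r b) _ _ _ _ _ _ Heven _ _ _ H);
          auto using row_class_lt; lia. }
    apply (safe_sound m n k (S k + 1 - d + 4) d 6 (far (min m 8) (k mod 2))) in Hsafe;
      auto; lia.
Qed.

(** * The starting position and the exact value *)

(** In both cases k is even and the slack is 1 or 2, so for k >= 6 the start lies in [far] with
    parity 0. Only n = 5 with k = 4 is smaller, and it is read off the table. *)
Lemma start_pos_resists (m n k : nat) :
  4 <= m -> 5 <= n -> (Nat.Odd n /\ k = n - 1 \/ Nat.Even n /\ k = n) ->
  ~ forces_mate m n k (start_pos m n).
Proof.
  intros Hm Hn Hk.
  assert (E : start_pos m n = cpos m n 0 (n - 1) (m - 1) (n - 1) 0 0).
  { unfold start_pos, cpos; rewrite !Nat.sub_0_r.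
    replace (m - (m - 1)) with 1 by lia; replace (n - (n - 1)) with 1 by lia; reflexivity. }
  assert (Hr : row_class (n - 1) (n - 1) = 5).
  { destruct (row_class_cases (n - 1) (n - 1)) as [[H _] | [[H _] | [_ [_ H]]]]; lia. }
  assert (Hm1 : min (m - 1) 7 = min m 8 - 1) by lia.
  rewrite E; destruct (Nat.eq_dec k 4) as [-> | Hk4].
  - assert (n = 5) as -> by lia.
    apply (tables_sound m 5 4); try lia.
    rewrite Hr, Hm1.
    pose proof (checks_min m Hm) as Hc; unfold checks in Hc; cbv zeta in Hc.
    rewrite !and_true in Hc; apply Hc.
  - assert (H6 : 6 <= k /\ k mod 2 = 0).
    { destruct Hk as [[[h Eh] ->] | [[h Eh] ->]]; split; try lia.
      - replace (n - 1) with (h * 2) by lia; apply Nat.Div0.mod_mul.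
      - rewrite Eh, Nat.mul_comm; apply Nat.Div0.mod_mul. }
    destruct H6 as [H6 Hp].
    apply (far_sound m n k); try lia.
    rewrite Hr, Hm1, Hp.
    assert (Hs : k + 1 - (n - 1) = 1 \/ k + 1 - (n - 1) = 2) by lia.
    assert (HM : min m 8 = 4 \/ min m 8 = 5 \/ min m 8 = 6 \/ min m 8 = 7 \/ min m 8 = 8) by lia.
    destruct Hs as [-> | ->], HM as [-> | [-> | [-> | [-> | ->]]]]; reflexivity.
Qed.

Theorem mainTheorem1 (m n : nat) :
  4 <= m -> 5 <= n ->
  let FM := if Nat.odd n then n else n + 1 in
  forces_mate m n FM (start_pos m n) /\
  (forall k, k < FM -> ~ forces_mate m n k (start_pos m n)).
Proof.
  intros Hm Hn FM; split; [exact (start_pos_forces_mate m n Hm Hn)|].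
  intros k Hk Hf; apply (start_pos_resists m n (FM - 1) Hm Hn).
  - unfold FM in *; destruct (Nat.odd n) eqn:E.
    + left; split; [apply Nat.odd_spec, E | reflexivity].
    + right; split; [|lia].
      apply Nat.even_spec; rewrite <- Nat.negb_odd, E; reflexivity.
  - apply (forces_mate_le m n k); [lia | exact Hf].
Qed.
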